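(* Let $I$ be a finite set, and let $\{L_i\}_{i\in I}$ and $\{M_i\}_{i\in I}$ be collections of (nonempty) affine subspaces of finite-dimensional real vector spaces $L$ and $M$ respectively, with unions $X=\bigcup_{i\in I}L_i$ and $Y=\bigcup_{i\in I}M_i$ and nerves $K_X$ and $K_Y$. If $K_X\ge K_Y$, then there exists a map $f\colon X\to Y$ compatible with $K_X$ and $K_Y$.
   Context: The nerve $K_X$ of the covering of $X$ by the $L_i$ is the simplicial complex with one vertex for each $i\in I$, in which $i_1,\ldots,i_k$ span a simplex if and only if $L_{i_1}\cap\cdots\cap L_{i_k}\ne\varnothing$; $K_Y$ is defined in the same way from the $M_i$. $K_X\ge K_Y$ means that for any $J\subset I$, $\bigcap_{j\in J}L_j\neq\varnothing$ implies $\bigcap_{j\in J}M_j\ne\varnothing$. A continuous map $f\colon X\to Y$ is compatible with $K_X$ and $K_Y$ if $x\in L_{i_1}\cap\cdots\cap L_{i_k}$ implies $f(x)\in M_{i_1}\cap\cdots\cap M_{i_k}$. *)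

(* Defs.v *)
From HB Require Import structures.
From mathcomp Require Import all_boot all_order all_algebra.
From mathcomp Require Import all_classical all_reals all_analysis.
Import GRing.Theory Num.Theory numFieldNormedType.Exports passmx.

Set Implicit Arguments.
Unset Strict Implicit.
Unset Printing Implicit Defensive.

Local Open Scope classical_set_scope.
Local Open Scope ring_scope.

(* The standard topology of a finite-dimensional real vector space, carried
   over from row vectors by the coordinates in a basis. It does not depend on
   the basis, since all linear maps are continuous for it
   (linear_fd_continuous), and on 'rV[R]_n itself it is the usual topology
   (fd_topology_rV). *)
Definition fd_topology (R : realType) (V : vectType R) :=
  initial_topology (rVof (vbasis {:V})).

HB.instance Definition _ (R : realType) (V : vectType R) :=
  Uniform.on (fd_topology V).

Lemma linear_continuous_rV (R : realType) (m n : nat)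
    (h : {linear 'rV[R]_m -> 'rV[R]_n}) :
  continuous h.
Proof.
have cont_mx (A : 'M[R]_(m, n)) :
    continuous (fun u : 'rV[R]_m => (u *m A : 'rV[R]_n)).
  have -> : (fun u : 'rV[R]_m => (u *m A : 'rV[R]_n)) =
            (fun u => \sum_(i < m) u ord0 i *: row i A).
    by apply/funext => u; rewrite mulmx_sum_row.
  apply: continuous_big => [|i _ u]; first exact: add_continuous.
  apply: (@cvgZr_tmp _ _ _ (nbhs u) (nbhs_filter u)).
  exact: coord_continuous.
suff -> : (h : 'rV[R]_m -> 'rV[R]_n) = (fun u => u *m lin1_mx h).
  exact: cont_mx.
by apply/funext => u; rewrite mul_rV_lin1.
Qed.

Lemma linear_fd_continuous (R : realType) (V W : vectType R)
    (h : {linear V -> W}) :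
  continuous (h : fd_topology V -> fd_topology W).
Proof.
pose g : {linear 'rV[R]_(\dim {:V}) -> 'rV[R]_(\dim {:W})} :=
  rVof (vbasis {:W}) \o h \o vecof (vbasis {:V}).
apply/continuousP => _ [B oB <-].
have /continuousP /(_ _ oB) oG := @linear_continuous_rV _ _ _ g.
exists (g @^-1` B) => //.
by apply/seteqP; split => x; rewrite /g /= rVofK ?vbasisP.
Qed.

Lemma fd_topology_rV (R : realType) (n : nat) (A : set 'rV[R]_n) :
  open (A : set (fd_topology 'rV[R]_n)) <-> open A.
Proof.
set e := vbasis {:'rV[R]_n}.
split=> [[B oB <-]|oA].
  have /continuousP := @linear_continuous_rV _ _ _ (rVof e); exact.
exists (vecof e @^-1` A).
  have /continuousP := @linear_continuous_rV _ _ _ (vecof e); exact.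
by apply/seteqP; split => x /=; rewrite rVofK ?vbasisP.
Qed.

(* Such a set is automatically nonempty. *)
Definition affine_subspace (R : realType) (V : vectType R) (A : set V) :=
  exists (p : V) (U : {vspace V}), A = [set p + u | u in [set` U]].

(* The family of all simplices. The empty simplex is included: the
   intersection over the empty set of indices is the whole space. *)
Definition nerve (V : Type) (I : finType) (A : I -> set V) : set {set I} :=
  [set J : {set I} | (\bigcap_(j in [set` J]) A j) !=set0].

Definition nerve_ge (I : finType) (K K' : set {set I}) :=
  forall J : {set I}, K J -> K' J.

(* Maps X -> Y between the unions of the two families are represented by
   functions defined on the whole space, whose values outside X are
   irrelevant. *)
Definition compatible_map (R : realType) (V W : vectType R) (I : finType)
    (A : I -> set V) (B : I -> set W) (f : V -> W) :=
  let X := \bigcup_i A i in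
  let Y := \bigcup_i B i in
  [/\ set_fun X Y f,
      {within (X : set (fd_topology V)),
        continuous (f : fd_topology V -> fd_topology W)} &
      forall (J : {set I}) (x : V),
        (\bigcap_(j in [set` J]) A j) x -> (\bigcap_(j in [set` J]) B j) (f x)].

(* Main.v *)
Require Import Defs.
From mathcomp Require Import all_boot all_order all_algebra.
From mathcomp Require Import all_classical all_reals all_analysis.
Import Order.TTheory GRing.Theory Num.Theory numFieldNormedType.Exports passmx.

(** For [x] in the space write [J(x)] for the set of all [i] with [x] in [L_i].
   Each [J] in the nerve of the [L_i] is in the nerve of the [M_i], so there is
   a point [m_J] in the intersection of the [M_j] with [j] in [J].  The sets
     [U_J = {x | J(x) is included in J}],
   indexed by the simplices [J] of the nerve, are open since [U_J] is the
   complement of the union of the [L_i] with [i] outside [J]; they cover the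
   space since [x] is in [U_(J(x))].  With a partition of unity [w_J]
   subordinate to this cover put
     [f x = \sum_J w_J(x) *: m_J].
   If [x] is in [L_i], then [w_J(x) != 0] forces [i] to be in [J], so that only
   points [m_J] of [M_i] contribute, and an affine combination of points of the
   affine subspace [M_i] is in [M_i].

   The partition of unity is explicit (lemma [nerve_partition_of_unity]): the
   product over [i] outside [J] of functions that vanish exactly on [L_i]
   (lemma [affine_subspace_zero_set]) is positive exactly on [U_J], and one
   divides these products by their sum.  The resulting [f] is defined and
   continuous on all of [L], so that no extension theorem is involved. *)

Local Open Scope classical_set_scope.
Local Open Scope ring_scope.

Lemma affine_subspace_comb (R : realType) (V : vectType R) (A : set V)
    (T : finType) (P : pred T) (c : T -> R) (m : T -> V) :
  affine_subspace A -> \sum_(t | P t) c t = 1 ->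
  (forall t, P t -> c t != 0 -> A (m t)) ->
  A (\sum_(t | P t) c t *: m t).
Proof.
move=> [p [U ->]] c1 mA.
exists (\sum_(t | P t) c t *: (m t - p)).
  apply: memv_suml => t Pt.
  have [->|ct0] := eqVneq (c t) 0; first by rewrite scale0r mem0v.
  by have [u uU <-] := mA t Pt ct0; rewrite addrC addKr memvZ.
under eq_bigr do rewrite scalerBr.
by rewrite sumrB -scaler_suml c1 scale1r addrC subrK.
Qed.

(** With [A = p + U], the function is the norm of the coordinates of the
   component of [x - p] along a complement of [U]. *)
Lemma affine_subspace_zero_set (R : realType) (V : vectType R) (A : set V) :
  affine_subspace A ->
  exists g : V -> R, [/\ continuous (g : fd_topology V -> R),
    forall x, 0 <= g x & forall x, (g x == 0) = (x \in A)].
Proof.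
move=> [p [U ->]].
pose e := vbasis {:V}.
pose h : {linear V -> 'rV[R]_(\dim {:V})} := rVof e \o (\1 - projv U)%VF.
exists (fun x => `|h x - h p|); split => // [|x].
  pose k : {linear 'rV[R]_(\dim {:V}) -> 'rV[R]_(\dim {:V})} := h \o vecof e.
  have ch : continuous (h : fd_topology V -> 'rV[R]_(\dim {:V})).
    have -> : (h : V -> _) = k \o rVof e.
      by apply/funext => x /=; rewrite rVofK ?vbasisP.
    move=> x; apply: continuous_comp; first exact: initial_continuous.
    exact: linear_continuous_rV.
  have cdist (W : normedModType R) (c : W) : continuous (fun u : W => `|u - c|).
    by move=> u; apply: cvg_norm; apply: cvgB; [exact: cvg_id | exact: cvg_cst].
  move=> x; refine (@continuous_comp (fd_topology V) _ _ h
    (fun u : 'rV[R]_(\dim {:V}) => `|u - h p|) x (ch x) _).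
  exact: cdist.
rewrite normr_eq0 -linearB /= add_lfunE opp_lfunE id_lfunE.
apply/eqP/idP => [h0|].
  apply/mem_set; exists (x - p); last by rewrite addrC subrK.
  have : vecof e (rVof e (x - p - projv U (x - p))) = 0 by rewrite h0 linear0.
  rewrite rVofK ?vbasisP// => /eqP; rewrite subr_eq0 => /eqP ->.
  exact: memv_proj.
by move/set_mem => -[u uU <-]; rewrite (addrC p) addrK projv_id// subrr linear0.
Qed.

Lemma continuous_fd_comb (R : realType) (T : topologicalType) (V : vectType R)
    (S : finType) (P : pred S) (c : S -> T -> R) (m : S -> V) :
  (forall s, continuous (c s)) ->
  continuous (fun x : T => \sum_(s | P s) c s x *: m s : fd_topology V).
Proof.
move=> cc; apply: continuous_comp_initial.
rewrite [X in continuous X](_ : _ = fun x : T =>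
    \sum_(s | P s) c s x *: rVof (vbasis {:V}) (m s)); last first.
  apply/funext => x; rewrite [LHS]linear_sum; apply: eq_bigr => s _.
  exact: linearZ.
apply: continuous_big => [|s _ x]; first exact: add_continuous.
by apply: cvgZr_tmp; exact: cc.
Qed.

(** The last conclusion says that [w J] is supported, in the algebraic sense,
   in the open set of the points whose members [A i] all have [i] in [J]. *)
Lemma nerve_partition_of_unity (R : realType) (T : topologicalType)
    (I : finType) (A : I -> set T) (g : I -> T -> R) :
  (forall i, continuous (g i)) -> (forall i x, 0 <= g i x) ->
  (forall i x, (g i x == 0) = (x \in A i)) ->
  exists w : {set I} -> T -> R, [/\ forall J, continuous (w J),
    forall x, \sum_(J in nerve A) w J x = 1 &
    forall J i x, A i x -> w J x != 0 -> i \in J].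
Proof.
move=> cg g0 gA.
pose v (J : {set I}) x := \prod_(i | i \notin J) g i x.
pose s x := \sum_(J in nerve A) v J x.
have cv J : continuous (v J).
  by apply: continuous_big => // x; exact: mul_continuous.
have cs : continuous s by apply: continuous_big => //; exact: add_continuous.
have v0 J x : 0 <= v J x by exact: prodr_ge0.
have s0 x : s x != 0.
  (* the term of the sum given by all members of the family through x *)
  pose J := [set i | x \in A i]%SET.
  have JA : J \in nerve A.
    by apply/mem_set; exists x => i /=; rewrite inE => /set_mem.
  rewrite gt_eqF// /s (bigD1 J) //= ltr_wpDr ?sumr_ge0// prodr_gt0// => i.
  by rewrite inE -gA lt_neqAle g0 andbT eq_sym.
exists (fun J x => v J x / s x); split=> [J x|x|J i x Aix].
- by apply: cvgM; [exact: cv | apply: cvgV; [exact: s0 | exact: cs]].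
- by rewrite -mulr_suml; exact: divff (s0 x).
- apply: contraNT => iJ; rewrite /v (bigD1 i) //=.
  by have /eqP -> : g i x == 0 by [rewrite gA; exact/mem_set]; rewrite !mul0r.
Qed.

Theorem theorem3p11 (R : realType) (I : finType) (L M : vectType R)
    (Li : I -> set L) (Mi : I -> set M)
    (affL : forall i : I, affine_subspace (Li i))
    (affM : forall i : I, affine_subspace (Mi i))
    (hK : nerve_ge (nerve Li) (nerve Mi)) :
  exists f : L -> M, compatible_map Li Mi f.
Proof.
have /choice[g gP] := fun i => affine_subspace_zero_set _ _ _ (affL i).
have [w [cw w1 wL]] := nerve_partition_of_unity R (fd_topology L) I Li g
  (fun i => let: And3 cg _ _ := gP i in cg)
  (fun i => let: And3 _ g0 _ := gP i in g0)
  (fun i => let: And3 _ _ gL := gP i in gL).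
have /choice[m mP] (J : {set I}) : exists y : M,
    J \in nerve Li -> (\bigcap_(j in [set` J]) Mi j) y.
  have [/set_mem/hK[y My]|_] := boolP (J \in nerve Li); first by exists y.
  by exists 0.
pose f x := \sum_(J in nerve Li) w J x *: m J.
have fM i x : Li i x -> Mi i (f x).
  move=> Lix; apply: affine_subspace_comb => // J JL wJ.
  by apply: mP => //=; exact: wL wJ.
exists f; split.
- by move=> x [i _ Lix]; exists i => //; exact: fM.
- by apply: continuous_subspaceT; exact: continuous_fd_comb.
- by move=> J x Lx j jJ; apply: fM; exact: Lx.
Qed.
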